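(* There exists a universal constant $C$ (one can take $C=4\sqrt{2}e<16$) such that the following holds. Let $n\ge1$, $\alpha>0$, $\beta>0$, and let $X$ be a symmetric random vector with values in $\mathbb{R}^n$ whose moments grow $\alpha$-regularly. Suppose moreover that $X$ satisfies convex $\mathrm{IC}(\beta)$. Then for every norm $\|\cdot\|$ on $\mathbb{R}^n$ and every $p\ge 2$, $$\Bigl(\mathbb{E}\bigl|\,\|X\|-\mathbb{E}\|X\|\,\bigr|^p\Bigr)^{1/p}\le C\,\alpha\,\beta\,\sigma_{\|\cdot\|,X}(p).$$
   Context: A random vector $X$ is symmetric if $X$ and $-X$ have the same distribution. For a real random variable $Y$ and $p\ge1$, $\|Y\|_p:=(\mathbb{E}|Y|^p)^{1/p}$. The moments of a random vector $X$ in $\mathbb{R}^n$ grow $\alpha$-regularly if for every $p\ge q\ge 2$ and every $\theta\in S^{n-1}$ we have $\|\langle X,\theta\rangle\|_p\le \alpha\frac{p}{q}\|\langle X,\theta\rangle\|_q$. The $p$-th weak moment of $X$ associated with a norm $\|\cdot\|$ on $\mathbb{R}^n$ is $\sigma_{\|\cdot\|,X}(p):=\sup_{\|t\|_*\le 1}\|\langle t,X\rangle\|_p$, where $\|\cdot\|_*$ is the dual norm of $\|\cdot\|$. If it is infinite, the asserted inequality is regarded as trivially true. $\Lambda_X(y)=\ln\mathbb{E}\,e^{\langle y,X\rangle}\in(-\infty,\infty]$ is the cumulant-generating function and $\Lambda_X^*(x)=\sup_{y\in\mathbb{R}^n}\{\langle x,y\rangle-\Lambda_X(y)\}\in[0,\infty]$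 is its Legendre transform. For $f:\mathbb{R}^n\to\mathbb{R}$ and $\varphi:\mathbb{R}^n\to[0,\infty]$, $(f\,\square\,\varphi)(x)=\inf\{f(y)+\varphi(x-y):y\in\mathbb{R}^n\}$. $X$ satisfies convex $\mathrm{IC}(\beta)$ if, with $\varphi(x)=\Lambda_X^*(x/\beta)$, one has $\mathbb{E}\,e^{(f\square\varphi)(X)}\,\mathbb{E}\,e^{-f(X)}\le 1$ for every convex $f:\mathbb{R}^n\to\mathbb{R}$ bounded from below. *)

(* Defs.v *)
From HB Require Import structures.
From mathcomp Require Import all_boot all_order all_algebra.
From mathcomp Require Import all_classical all_reals all_analysis.

Set Implicit Arguments.
Unset Strict Implicit.
Unset Printing Implicit Defensive.

Import Order.TTheory GRing.Theory Num.Theory.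
Import numFieldNormedType.Exports.

Local Open Scope classical_set_scope.
Local Open Scope ring_scope.

(* R^n, as row vectors, with its Borel sigma-algebra. *)
Definition borel_rV (R : realType) (n : nat) :=
  g_sigma_algebraType (@open 'rV[R]_n).

Section VectorsAndNorms.
Context {R : realType} {n : nat}.
Implicit Types (x y t : 'rV[R]_n) (N : 'rV[R]_n -> R).

Definition dot x y : R := \sum_(i < n) x 0 i * y 0 i.

(* The library's norm on matrices is the sup norm, so the Euclidean one is
   defined here. *)
Definition euclidean_norm x : R := Num.sqrt (dot x x).

(* Nonnegativity follows from the first two conditions. *)
Record is_norm N : Prop := IsNorm {
  norm_triangle : forall x y, N (x + y) <= N x + N y ;
  norm_homogeneous : forall (a : R) x, N (a *: x) = `|a| * N x ;
  norm_definite : forall x, N x = 0 -> x = 0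
}.

Local Open Scope ereal_scope.

Definition dual_norm N t : \bar R :=
  ereal_sup [set (dot t x)%:E | x in [set x | (N x <= 1)%R]].

Definition inf_convolution (f : 'rV[R]_n -> R) (phi : 'rV[R]_n -> \bar R) x :
    \bar R :=
  ereal_inf [set (f y)%:E + phi (x - y)%R | y in [set: 'rV[R]_n]].

End VectorsAndNorms.

Section RandomVectors.
Context {d : measure_display} {T : measurableType d} {R : realType} {n : nat}.
Variables (P : probability T R) (X : {RV P >-> borel_rV R n}).

Definition symmetric_rv : Prop := forall A : set (borel_rV R n),
  measurable A ->
  P (X @^-1` A) = P ((fun w => - (X w : 'rV[R]_n)) @^-1` A).

Local Open Scope ereal_scope.

(* The norm ||<t, X>||_p, possibly infinite. *)
Definition moment (p : R) (t : 'rV[R]_n) : \bar R :=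
  'N[P]_(p%:E)[(fun w => (dot t (X w))%:E)].

Definition moments_grow_regularly (alpha : R) : Prop :=
  forall (p q : R) (theta : 'rV[R]_n),
    (2 <= q)%R -> (q <= p)%R -> euclidean_norm theta = 1%R ->
    moment p theta <= (alpha * (p / q))%:E * moment q theta.

Definition weak_moment (N : 'rV[R]_n -> R) (p : R) : \bar R :=
  ereal_sup [set moment p t | t in [set t | dual_norm N t <= 1]].

Definition cumulant (y : 'rV[R]_n) : \bar R :=
  lne 'E_P[fun w => expR (dot y (X w))].

Definition cumulant_legendre (x : 'rV[R]_n) : \bar R :=
  ereal_sup [set (dot x y)%:E - cumulant y | y in [set: 'rV[R]_n]].

Definition convex_IC (beta : R) : Prop :=
  let phi x := cumulant_legendre (beta^-1 *: x)%R in
  forall f : 'rV[R]_n -> R,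
    convex_function (E := 'rV[R]_n) setT f -> has_lbound (range f) ->
    (\int[P]_w expeR (inf_convolution f phi (X w))) *
      'E_P[fun w => expR (- f (X w))] <= 1.

End RandomVectors.

(* Main.v *)
Require Import Defs.
From HB Require Import structures.
From mathcomp Require Import all_boot all_order all_algebra.
From mathcomp Require Import all_classical all_reals all_analysis.
From mathcomp Require Import measurable_realfun ring lra.

(* Fix a finite sig >= weak_moment X N p and put tau = alpha * sig,
   s = p / (2 e tau), lam = s / beta, M = 4 e^p.  If N^*(t) <= 1 and
   Y = <t, X>, regularity bounds E|Y|^k by 2 tau^k for k <= p and by
   (tau k / p)^k for k > p; summing the exponential series with k^k <= e^k k!
   gives E exp(s |Y|) <= M, i.e. Lambda_X (s t) <= ln M on the dual ball.  By
   Hahn-Banach N is the supremum of <t, .> over that ball, so for f = lam N the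
   infimum convolution of f with the cost is at least lam N - ln M, and
   IC(beta) becomes E exp(lam N(X)) * E exp(- lam N(X)) <= M.  Jensen turns this
   into E exp(lam |N(X) - E N(X)|) <= 2M, and u^p <= (p / e)^p e^u yields the
   p-th moment bound (p / (e lam)) (2M)^(1/p) <= 4 sqrt 2 e alpha beta sig. *)

Set Implicit Arguments.
Unset Strict Implicit.
Unset Printing Implicit Defensive.

Import Order.TTheory GRing.Theory Num.Theory.
Import numFieldNormedType.Exports.

Local Open Scope classical_set_scope.
Local Open Scope ring_scope.

(** * Sublinear functionals and flattening along finitely many vectors *)

Definition sublinear (R : realType) (V : lmodType R) (q : V -> R) :=
  (forall x y, q (x + y) <= q x + q y) /\
  (forall (a : R) x, 0 <= a -> q (a *: x) = a * q x).

Lemma sublinear0 (R : realType) (V : lmodType R) (q : V -> R) :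
  sublinear q -> q 0 = 0.
Proof. by move=> [_ /(_ 0 0 (lexx _))]; rewrite scale0r mul0r. Qed.

Lemma sublinear_geN (R : realType) (V : lmodType R) (q : V -> R) x :
  sublinear q -> - q (- x) <= q x.
Proof.
move=> sq; have := sq.1 x (- x).
by rewrite subrr (sublinear0 sq) -lerBlDr sub0r.
Qed.

(** [q' x] is the infimum of [q (x + r *: v) - r * q v] over [r >= 0], bounded below by [- q (- x)].
    Taking [r = 0] gives [q' <= q], and [r = 1] at [- v] gives the last bound, which makes [q']
    linear on the line through [v]. Finitely many such steps replace Zorn's lemma in Hahn-Banach. *)
Lemma sublinear_flatten (R : realType) (V : lmodType R) (q : V -> R) (v : V) :
  sublinear q -> exists q' : V -> R,
    [/\ sublinear q', forall x, q' x <= q x & q' (- v) <= - q v].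
Proof.
move=> sq; have [qD qZ] := sq.
pose S x := [set q (x + r *: v) - r * q v | r in [set r : R | 0 <= r]].
have S0 x : S x !=set0 by exists (q (x + 0 *: v) - 0 * q v), 0 => /=.
have lbS x : lbound (S x) (- q (- x)).
  move=> _ [r /= r0 <-]; rewrite lerBrDl -(qZ _ _ r0) addrC.
  have := qD (x + r *: v) (- x).
  by rewrite addrAC subrr add0r => /[dup] h; lra.
have hlb x : has_lbound (S x) by exists (- q (- x)).
pose q' x := inf (S x).
have q'le x r : 0 <= r -> q' x <= q (x + r *: v) - r * q v.
  by move=> r0; apply: ge_inf => //; exists r.
have q'D x y : q' (x + y) <= q' x + q' y.
  rewrite -lerBlDr; apply: lb_le_inf => // _ [r /= r0 <-].
  rewrite lerBlDr -lerBlDl; apply: lb_le_inf => // _ [s /= s0 <-].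
  rewrite lerBlDl; apply: le_trans (q'le _ (r + s) (addr_ge0 r0 s0)) _.
  have := qD (x + r *: v) (y + s *: v).
  by rewrite addrACA -scalerDl mulrDl; lra.
have q'q x : q' x <= q x.
  by have := q'le x 0 (lexx _); rewrite scale0r addr0 mul0r subr0.
have q'0 : q' 0 = 0.
  apply/eqP; rewrite eq_le -{1}(sublinear0 sq) q'q/=.
  by apply: lb_le_inf => // y /lbS; rewrite oppr0 (sublinear0 sq) oppr0.
have q'Zle a x : 0 < a -> q' (a *: x) <= a * q' x.
  move=> a0; rewrite mulrC -ler_pdivrMr//; apply: lb_le_inf => // _ [r /= r0 <-].
  rewrite ler_pdivrMr// mulrC mulrBr -(qZ _ _ (ltW a0)) scalerDr scalerA mulrA.
  by apply: q'le; rewrite mulr_ge0// ltW.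
exists q'; split=> //.
- split=> // a x; rewrite le_eqVlt => /predU1P[<-|a0].
    by rewrite scale0r mul0r.
  (* The reverse inequality is [q'Zle] for the factor [a^-1] at the vector [a *: x]. *)
  apply/eqP; rewrite eq_le q'Zle//= mulrC -ler_pdivlMr// mulrC.
  by rewrite -{1}[x](scalerK (lt0r_neq0 a0)) q'Zle// invr_gt0.
- have := q'le (- v) 1 ler01.
  by rewrite scale1r addNr (sublinear0 sq) mul1r sub0r.
Qed.

(** Flatness along [u] survives later steps: decreasing the functional lowers its value at [- u] and
    raises the negative of its value at [u]. *)
Lemma sublinear_flatten_seq (R : realType) (V : lmodType R) (q : V -> R)
    (s : seq V) :
  sublinear q -> exists q' : V -> R,
    [/\ sublinear q', forall x, q' x <= q x &
        forall v, v \in s -> q' (- v) <= - q' v].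
Proof.
move=> sq; elim: s => [|v s [q1 [sq1 q1q q1s]]]; first by exists q; split.
have [q2 [sq2 q2q1 q2v]] := sublinear_flatten v sq1.
exists q2; split=> // [x|u]; first exact: le_trans (q2q1 x) (q1q x).
rewrite inE => /predU1P[->|us].
  by apply: le_trans q2v _; rewrite lerN2.
apply: le_trans (q2q1 _) _; apply: le_trans (q1s _ us) _.
by rewrite lerN2.
Qed.

(** * The scalar product, norming functionals and continuity of seminorms *)

Section Dot.
Context {R : realType} {n : nat}.
Implicit Types (x y t z : 'rV[R]_n) (N : 'rV[R]_n -> R).

Lemma dotDr t x y : dot t (x + y) = dot t x + dot t y.
Proof.
by rewrite /dot -big_split; apply: eq_bigr => i _; rewrite mxE mulrDr.
Qed.

Lemma dotZr a t x : dot t (a *: x) = a * dot t x.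
Proof.
by rewrite /dot mulr_sumr; apply: eq_bigr => i _; rewrite mxE mulrCA.
Qed.

Lemma dotC x y : dot x y = dot y x.
Proof. by apply: eq_bigr => i _; rewrite mulrC. Qed.

Lemma dotZl a t x : dot (a *: t) x = a * dot t x.
Proof. by rewrite dotC dotZr dotC. Qed.

Lemma dotBr t x y : dot t (x - y) = dot t x - dot t y.
Proof. by rewrite -scaleN1r dotDr dotZr mulN1r. Qed.

(* Flattening a sublinear functional along every basis vector leaves a linear
   one. *)
Lemma norming_functional N z : is_norm N ->
  exists t, (forall x, dot t x <= N x) /\ dot t z = N z.
Proof.
move=> [ND NZ _].
have sN : sublinear N by split=> // a x a0; rewrite NZ ger0_norm.
(* Flattening along [z] first gives [q1 (- z) <= - N z], which at the end forces the value [N z] at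
   [z]. *)
have [q1 [sq1 q1N q1z]] := sublinear_flatten z sN.
have [q [sq qq1 qe]] :=
  sublinear_flatten_seq [seq delta_mx 0 i | i <- enum 'I_n] sq1.
pose t : 'rV[R]_n := \row_i q (delta_mx 0 i).
have qle x : q x <= dot t x.
  rewrite {1}(row_sum_delta x) /dot.
  apply: (big_ind2 (fun u r => q u <= r)) => [|u r v w qu qv|i _].
  - by rewrite (sublinear0 sq).
  - by apply: le_trans (sq.1 _ _) _; exact: lerD.
  (* A negative coordinate is written as a nonnegative multiple of the opposite basis vector, where
     flatness applies. *)
  - rewrite mxE mulrC; have [x0|x0] := leP 0 (x 0 i); first by rewrite sq.2.
    rewrite -[x 0 i *: _]opprK -scaleNr -scalerN sq.2; last by rewrite oppr_ge0 ltW.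
    rewrite mulNr -mulrN (ler_wnM2l (ltW x0))// lerNr qe//.
    by apply: map_f; rewrite mem_enum.
(* Since [dot t] is odd, [qle] at [- x] gives [dot t x <= - q (- x) <= q x]. *)
have qE x : dot t x = q x.
  apply/eqP; rewrite eq_le qle andbT; apply: le_trans (sublinear_geN x sq).
  by have := qle (- x); rewrite -scaleN1r dotZr mulN1r scaleN1r lerNr.
exists t; split=> [x|]; first by rewrite qE (le_trans (qq1 x)).
apply/eqP; rewrite eq_le !qE (le_trans (qq1 z) (q1N z))/=.
apply: le_trans (sublinear_geN z sq); rewrite lerNr.
exact: le_trans (qq1 _) q1z.
Qed.

Lemma dual_norm_le1P N t : (dual_norm N t <= 1)%E <->
  (forall x, N x <= 1 -> dot t x <= 1).
Proof.
split=> [tN x Nx|tN].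
  rewrite -lee_fin; apply: le_trans tN; apply: ereal_sup_ubound.
  by exists x.
by apply: ge_ereal_sup => _ [x /= Nx <-]; rewrite lee_fin tN.
Qed.

(** Expanding along the basis bounds [q] by [K] times the sup norm, so [f] is Lipschitz. The
    seminorm [q] will be the norm itself, or the absolute value of [dot t]. The summand 1 keeps [K]
    positive for the division. *)
Lemma seminorm_lipschitz_continuous (f q : 'rV[R]_n -> R) :
  (forall x y, q (x + y) <= q x + q y) ->
  (forall a x, q (a *: x) = `|a| * q x) ->
  (forall x y, `|f x - f y| <= q (x - y)) -> continuous f.
Proof.
move=> qD qZ fq.
have q0 x : 0 <= q x.
  have := qD x (- x); rewrite subrr -(scale0r 0) qZ normr0 mul0r -scaleN1r qZ.
  by rewrite normrN normr1 mul1r; lra.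
pose K := 1 + \sum_(i < n) q (delta_mx 0 i).
have K0 : 0 < K by rewrite /K ltr_wpDr// sumr_ge0.
have qK x : q x <= K * `|x|.
  apply: (@le_trans _ _ (\sum_(i < n) `|x 0 i| * q (delta_mx 0 i))).
    rewrite {1}(row_sum_delta x).
    apply: (big_ind2 (fun u r => q u <= r)) => [|u r v w qu qv|i _].
    - by rewrite -(scale0r 0) qZ normr0 mul0r.
    - by apply: le_trans (qD _ _) _; exact: lerD.
    - by rewrite qZ.
  apply: (@le_trans _ _ (\sum_(i < n) `|x| * q (delta_mx 0 i))).
    apply: ler_sum => i _; apply: ler_wpM2r => //.
    rewrite [leRHS]/Num.norm/= mx_normrE; apply/bigmax_geP; right => /=.
    by exists (0, i).
  by rewrite -mulr_sumr mulrC ler_wpM2r// /K lerDr.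
move=> x A /nbhs_ballP[e /= e0 eA].
apply/nbhs_ballP; exists (e / K); first exact: divr_gt0.
move=> y; rewrite -ball_normE/= ltr_pdivlMr// mulrC => xy.
apply: eA; rewrite -ball_normE/=; exact: le_lt_trans (le_trans (fq _ _) (qK _)) xy.
Qed.

End Dot.

(** * Elementary inequalities for the real exponential *)

Section ExponentialEstimates.
Context {R : realType}.
Implicit Types (a p u x : R) (k n : nat).

Lemma expn_fact_le_expR k : k%:R ^+ k / k`!%:R <= expR k%:R :> R.
Proof.
case: k => [|k]; first by rewrite expr0 fact0 divr1 expR0.
by apply: le_trans (expR_ge1Dxn k (ler0n _ _)); rewrite lerDr.
Qed.

Lemma exp_coeff_sum_le x n :
  0 <= x -> \sum_(0 <= k < n) x ^+ k / k`!%:R <= expR x.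
Proof.
move=> x0; apply: (@nondecreasing_cvgn_le _ (series (exp_coeff x))).
  apply: nondecreasing_series => k _ _.
  by rewrite /exp_coeff/= divr_ge0// exprn_ge0.
exact: is_cvg_series_exp_coeff.
Qed.

Lemma expR_nneseries x : 0 <= x ->
  (expR x)%:E = (\sum_(0 <= k <oo) (x ^+ k / k`!%:R)%:E)%E.
Proof.
move=> x0; rewrite /expR -EFin_lim; last exact: is_cvg_series_exp_coeff.
by congr (limn _); apply/funext => n /=; rewrite /series/= -sumEFin.
Qed.

(** This is [1 + v <= exp v] at [v = u / p - 1], raised to the power [p]; equality holds at
    [u = p]. *)
Lemma powR_le_expR p u : 0 < p -> 0 <= u ->
  u `^ p <= (p / expR 1) `^ p * expR u.
Proof.
move=> p0 u0.
have pe0 : 0 <= p / expR 1 by rewrite divr_ge0 ?expR_ge0 ?ltW.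
have -> : expR u = expR (u / p) `^ p by rewrite -expRM divfK// gt_eqF.
rewrite -powRM ?expR_ge0//; apply: ge0_ler_powR; rewrite ?nnegrE//.
- exact: ltW.
- by rewrite mulr_ge0// expR_ge0.
rewrite mulrAC -mulrA -expRB -ler_pdivrMl// mulrC.
by apply: le_trans (expR_ge1Dx _); rewrite addrC subrK.
Qed.

(** This controls all integer moments of order at most [p] by the [p]-th one, at the cost of the
    summand 1. *)
Lemma expn_le_1DpowR p u k : 0 <= u -> k%:R <= p -> u ^+ k <= 1 + u `^ p.
Proof.
move=> u0 kp; have [u1|/ltW u1] := leP u 1.
  by apply: (@le_trans _ _ 1); [exact: exprn_ile1|rewrite lerDl powR_ge0].
by rewrite -powR_mulrn// ler_wpDl// ler_powR.
Qed.

(** This is the numerical fact behind [C < 16]. It follows from [exp (- 1) = exp (- 1/16) ^ 16 >=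
    (15/16) ^ 16]. *)
Lemma expR1_lt_sqrt8 : expR 1 < 2 * Num.sqrt 2 :> R.
Proof.
have h3 : (3545 / 10000 : R) <= expR (-1).
  have -> : -1 = - 16^-1 * 16%:R :> R by rewrite mulNr mulVf// pnatr_eq0.
  apply: (@le_trans _ _ ((15 / 16 : R) ^+ 16)); first by lra.
  rewrite expRM_natr lerXn2r// ?nnegrE ?expR_ge0//.
  by apply: le_trans (expR_ge1Dx _); lra.
have h4 : expR 1 * (3545 / 10000) <= 1 :> R.
  by rewrite -[leRHS](expRxMexpNx_1 1) ler_pM2l// expR_gt0.
have h5 : expR 1 <= 2821 / 1000 :> R by lra.
apply: le_lt_trans h5 _; rewrite -ltr_pdivrMl//.
rewrite -[X in X < _]ger0_norm ?divr_ge0 ?mulr_ge0 ?invr_ge0 ?ler0n// -sqrtr_sqr.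
by rewrite ltr_sqrt; lra.
Qed.

End ExponentialEstimates.


(** * From moment growth to an exponential moment *)

Section Integrals.
Context {d} {T : measurableType d} {R : realType}.
Local Open Scope ereal_scope.

Import HBNNSimple.

(* The infimum convolution in [convex_IC] need not be measurable, so
   [ge0_le_integral] does not apply to it. *)
Lemma ge0_le_integral_nonmeas (mu : {measure set T -> \bar R})
    (f g : T -> \bar R) :
  (forall x, 0 <= f x) -> (forall x, f x <= g x) ->
  \int[mu]_x f x <= \int[mu]_x g x.
Proof.
move=> f0 fg; have g0 x : 0 <= g x by exact: le_trans (fg x).
rewrite !ge0_integralTE//; apply: ereal_sup_le => _ [h /= hf <-].
by exists h => // x; exact: le_trans (hf x) (fg x).
Qed.

Variable P : probability T R.

Lemma integral_powR_le_Lnorm (Y : T -> R) (q c : R) : (0 < q)%R -> (0 <= c)%R ->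
  'N[P]_(q%:E)[EFin \o Y] <= c%:E ->
  \int[P]_w ((`|Y w| `^ q)%R)%:E <= ((c `^ q)%R)%:E.
Proof.
move=> q0 c0 h; have := @poweR_Lnorm _ T R P (EFin \o Y) q (lt0r_neq0 q0).
under eq_integral do rewrite /=.
move=> <-; rewrite -poweR_EFin; apply: gt0_ler_poweR => //; first exact: ltW.
- by rewrite in_itv/= leey andbT Lnorm_ge0.
- by rewrite in_itv/= leey andbT lee_fin.
Qed.

Lemma exp_moment_regular (Y : T -> R) (p tau : R) :
  measurable_fun setT Y -> (1 <= p)%R -> (0 < tau)%R ->
  (forall q, (p <= q)%R -> 'N[P]_(q%:E)[EFin \o Y] <= (tau * (q / p))%:E) ->
  \int[P]_w (expR (p / (2 * expR 1 * tau) * `|Y w|))%:E <= (4 * expR p)%:E.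
Proof.
move=> mY p1 tau0 hY.
have p0 : (0 < p)%R by exact: lt_le_trans p1.
have e0 := @expR_gt0 R 1.
set s : R := (p / _)%R.
pose a : R := (p / (2 * expR 1))%R.
have a0 : (0 <= a)%R by rewrite divr_ge0 ?mulr_ge0 ?expR_ge0// ltW.
have s0 : (0 < s)%R by rewrite divr_gt0// !mulr_gt0.
have sE : s = (a / tau)%R by rewrite /s /a invfM mulrA.
pose F k (w : T) : R := ((s * `|Y w|) ^+ k / k`!%:R)%R.
have mF k : measurable_fun [set: T] (EFin \o F k).
  apply/measurable_EFinP; apply: measurable_funM => //.
  apply: measurable_funX; apply: measurable_funM => //.
  exact: measurableT_comp.
have sY0 w : (0 <= s * `|Y w|)%R by rewrite mulr_ge0// ltW.
have hq q : (p <= q)%R ->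
    \int[P]_w ((`|Y w| `^ q)%R)%:E <= (((tau * (q / p)) `^ q)%R)%:E.
  move=> pq; apply: integral_powR_le_Lnorm (hY _ pq).
    exact: lt_le_trans pq.
  by rewrite mulr_ge0 ?divr_ge0// ltW// (lt_le_trans p0).
(* The two summands cover the two regimes: [2 a^k / k!] for [k <= p] and [2^-k] for [k > p]. A
   single summable bound then serves every [k]. *)
have term k : \int[P]_w (((s * `|Y w|) ^+ k / k`!%:R)%R)%:E <=
    ((2 * (a ^+ k / k`!%:R) + 2^-1 ^+ k)%R)%:E.
  have kf : (0 < k`!%:R :> R)%R by rewrite ltr0n fact_gt0.
  have [kp|kp] := leP k%:R p.
  - pose A : R := (a ^+ k / k`!%:R)%R.
    have A0 : (0 <= A)%R by rewrite divr_ge0 ?exprn_ge0// ltW.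
    pose c : R := ((tau `^ p)^-1)%R.
    have c0 : (0 <= c)%R by rewrite invr_ge0 powR_ge0.
    (* With [u = |Y| / tau] the term is [A u^k <= A (1 + u^p)], and [u^p] has expectation at most 1
       by the hypothesis at [q = p]. *)
    have yk w : ((s * `|Y w|) ^+ k / k`!%:R <= A + A * c * `|Y w| `^ p)%R.
      have -> : ((s * `|Y w|) ^+ k / k`!%:R = A * (`|Y w| / tau) ^+ k)%R.
        by rewrite sE /A mulrAC -mulrA exprMn mulrAC.
      rewrite -mulrA -[X in (X + _)%R]mulr1 -mulrDr; apply: ler_wpM2l => //.
      have -> : (c * `|Y w| `^ p = (`|Y w| / tau) `^ p)%R.
        rewrite powRM ?invr_ge0 ?(ltW tau0)// -(powR_inv1 (ltW tau0)).
        by rewrite -powRrM mulN1r powRN mulrC.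
      by rewrite expn_le_1DpowR// divr_ge0// ltW.
    apply: (@le_trans _ _
        (\int[P]_w (A%:E + (A * c)%:E * (`|Y w| `^ p)%:E))).
      apply: ge0_le_integral_nonmeas => w.
        by rewrite lee_fin divr_ge0// exprn_ge0.
      by rewrite -EFinM -EFinD lee_fin.
    rewrite ge0_integralD//; last 2 first.
    - by move=> w _; rewrite -EFinM lee_fin mulr_ge0 ?powR_ge0// mulr_ge0.
    - apply/measurable_EFinP; apply: measurable_funM => //.
      apply: (measurableT_comp (measurable_powR _)).
      exact: measurableT_comp.
    rewrite integral_cst//= probability_setT mule1 ge0_integralZl_EFin//; last 2 first.
    - apply/measurable_EFinP; apply: (measurableT_comp (measurable_powR _)).
      exact: measurableT_comp.
    - by rewrite mulr_ge0.
    have := hq p (lexx _); rewrite divff ?gt_eqF// mulr1 => hp.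
    apply: (@le_trans _ _ (A%:E + (A * c)%:E * (tau `^ p)%:E)).
      by rewrite leeD2l// lee_wpmul2l// lee_fin mulr_ge0.
    rewrite -EFinM -EFinD lee_fin -mulrA mulVf ?gt_eqF ?powR_gt0//.
    by rewrite mulr1 -/A mulr_natl mulr2n lerDl exprn_ge0.
  - have k0 : (0 < k)%N by rewrite -(ltr0n R); exact: lt_trans kp.
    have pk := ltW kp; have := hq _ pk.
    under eq_integral do rewrite powR_mulrn//.
    rewrite powR_mulrn; last by rewrite mulr_ge0 ?divr_ge0// ltW.
    move=> hk.
    have sk0 : (0 <= s ^+ k / k`!%:R)%R by rewrite divr_ge0 ?exprn_ge0// ltW.
    under eq_integral do rewrite exprMn mulrAC EFinM.
    rewrite ge0_integralZl_EFin//; last first.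
      by apply/measurable_EFinP; apply: measurable_funX; exact: measurableT_comp.
    apply: le_trans (lee_wpmul2l _ hk) _; first by rewrite lee_fin.
    rewrite -EFinM lee_fin -[leLHS]add0r lerD//.
      by rewrite mulr_ge0// divr_ge0// exprn_ge0.
    rewrite mulrAC -exprMn.
    (* The choice of [s] makes the term at most [2^-k (k / e)^k / k!], and [k^k / k! <= e^k]. *)
    have -> : (s * (tau * (k%:R / p)) = 2^-1 * (k%:R * (expR 1)^-1))%R.
      by rewrite /s; field; rewrite !gt_eqF.
    rewrite exprMn -mulrA ler_piMr ?exprn_ge0// exprMn mulrAC exprVn -expRM_natl.
    by rewrite ler_pdivrMr ?expR_gt0// mul1r mulr1 expn_fact_le_expR.
rewrite (_ : (fun w => _) =
    (fun w => \sum_(0 <= k <oo) (EFin \o F k) w)); last first.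
  by apply/funext => w; rewrite expR_nneseries.
rewrite (integral_nneseries P measurableT mF); last first.
  by move=> k w _; rewrite lee_fin divr_ge0// exprn_ge0.
(* The exponential series contributes [2 exp a] and the geometric one 2. Both are at most [2 exp p],
   because [a <= p]. *)
apply: (@le_trans _ _ (2 * expR a + 2)%:E).
  apply: lime_le.
    apply: is_cvg_nneseries => k _ _; apply: integral_ge0 => w _.
    by rewrite lee_fin divr_ge0// exprn_ge0.
  near=> n.
  apply: (@le_trans _ _ (\sum_(0 <= k < n) ((2 * (a ^+ k / k`!%:R) + 2^-1 ^+ k)%R)%:E)).
    by apply: lee_sum => k _; exact: term.
  rewrite sumEFin lee_fin big_split/= -mulr_sumr lerD//.
    by rewrite ler_pM2l// exp_coeff_sum_le.
  rewrite (_ : \sum_(_ <= _ < _) _ = series (geometric 1 2^-1) n)%R; last first.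
    by rewrite /series/=; apply: eq_bigr => i _; rewrite mul1r.
  apply: le_trans (geometric_le_lim _ _ _ _) _ => //.
    by rewrite ger0_norm; lra.
  by rewrite (_ : 1 - 2^-1 = 2^-1)%R ?invrK ?mul1r//; lra.
have e1 : (1 <= expR p)%R by rewrite -expR0 ler_expR ltW.
have : (expR a <= expR p)%R.
  rewrite ler_expR /a ler_pdivrMr// ?mulr_gt0// ler_peMr ?ltW//.
  by have := expR_ge1Dx (1 : R); lra.
by rewrite lee_fin; lra.
Unshelve. all: by end_near. Qed.

End Integrals.

(** * Centered moments from a product of exponential moments *)

Section CenteredMoments.
Context {d} {T : measurableType d} {R : realType} (P : probability T R).
Local Open Scope ereal_scope.

(** A zero integral would make a positive function vanish almost everywhere, against [P setT = 1].
    Positivity of each factor lets a finite bound on a product bound the other factor. *)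
Lemma integral_expR_gt0 (f : T -> R) : measurable_fun [set: T] f ->
  0 < \int[P]_w (expR (f w))%:E.
Proof.
move=> mf.
have mef : measurable_fun [set: T] (EFin \o (fun w => expR (f w))).
  by apply/measurable_EFinP; exact: measurableT_comp.
have ef0 w : 0 <= (expR (f w))%:E by rewrite lee_fin expR_ge0.
rewrite lt_neqAle integral_ge0// andbT eq_sym; apply/negP => /eqP int0.
have /ae_eq_integral_abs : \int[P]_w `|(EFin \o (fun w => expR (f w))) w| = 0.
  rewrite -[RHS]int0; apply: eq_integral => w _; exact: gee0_abs (ef0 w).
move=> /(_ measurableT mef) [N [mN N0 subN]].
have : P [set: T] = 0.
  apply: (subset_measure0 _ _ _ N0) => //.
  move=> w _; apply: subN => /= /(_ Logic.I) /eqP.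
  by rewrite eqe expR_eq0.
by rewrite probability_setT => /eqP; rewrite onee_eq0.
Qed.

(* By Jensen, [exp(lam E Z) <= E exp(lam Z)] and
   [exp(- lam E Z) <= E exp(- lam Z)], so the product bounds both exponential
   moments of [Z - E Z]. *)
Lemma Lnorm_centered_le (Z : T -> R) (p lam M : R) :
  measurable_fun [set: T] Z -> (forall w, (0 <= Z w)%R) ->
  (0 < p)%R -> (0 < lam)%R ->
  (\int[P]_w (expR (lam * Z w))%:E) * (\int[P]_w (expR (- (lam * Z w)))%:E)
    <= M%:E ->
  'N[P]_(p%:E)[(fun w => (Z w)%:E - 'E_P[Z])] <=
    (p / (lam * expR 1) * (2 * M) `^ p^-1)%:E.
Proof.
move=> mZ Z0 p0 lam0.
set IA := (\int[P]_w (expR (lam * Z w))%:E).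
set IB := (\int[P]_w (expR (- (lam * Z w)))%:E) => AB.
have mlZ : measurable_fun [set: T] (fun w => lam * Z w)%R.
  exact: measurable_funM.
have mNlZ : measurable_fun [set: T] (fun w => - (lam * Z w))%R.
  exact: measurableT_comp.
have meA : measurable_fun [set: T] (fun w => expR (lam * Z w)).
  exact: measurableT_comp.
have meB : measurable_fun [set: T] (fun w => expR (- (lam * Z w))).
  exact: measurableT_comp.
have B0 : 0 < IB by exact: integral_expR_gt0.
have A0 : 0 < IA by exact: integral_expR_gt0.
(* An infinite factor times a positive one would be infinite, against the bound [M]. *)
have Afin : IA < +oo.
  rewrite ltey; apply/eqP => Ay; move: AB; rewrite Ay gt0_mulye//.
have Bfin : IB < +oo.
  rewrite ltey; apply/eqP => By; move: AB; rewrite By gt0_muley//.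
have iA : P.-integrable [set: T] (EFin \o (fun w => expR (lam * Z w))).
  apply/integrableP; split; first exact/measurable_EFinP.
  by under eq_integral do rewrite gee0_abs ?lee_fin ?expR_ge0//.
have iB : P.-integrable [set: T] (EFin \o (fun w => expR (- (lam * Z w)))).
  apply/integrableP; split; first exact/measurable_EFinP.
  by under eq_integral do rewrite gee0_abs ?lee_fin ?expR_ge0//.
have ilZ : P.-integrable [set: T] (EFin \o (fun w => lam * Z w)%R).
  apply: le_integrable iA => //; first exact/measurable_EFinP.
  move=> w _ /=; rewrite lee_fin (ger0_norm (expR_ge0 _)).
  rewrite ger0_norm; last by rewrite mulr_ge0// ltW.
  by apply: le_trans (expR_ge1Dx _); rewrite lerDr.
have iZ : P.-integrable [set: T] (EFin \o Z).
  have := @integrableZl _ _ _ P _ measurableT lam^-1 _ ilZ.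
  rewrite (_ : (fun x => _) = EFin \o Z)//; apply/funext => w /=.
  by rewrite -EFinM mulKf// gt_eqF.
have Efin : 'E_P[Z] \is a fin_num by rewrite unlock; exact: integrable_fin_num.
pose m := fine 'E_P[Z].
have EE : 'E_P[Z] = m%:E by rewrite fineK.
have ElZ : \int[P]_w (lam * Z w)%:E = (lam * m)%:E.
  under eq_integral do rewrite EFinM.
  by rewrite integralZl// EFinM -EE unlock.
pose a := fine IA; pose b := fine IB.
have aE : IA = a%:E by apply/esym/fineK; rewrite gt0_fin_numE.
have bE : IB = b%:E by apply/esym/fineK; rewrite gt0_fin_numE.
have abM : (a * b <= M)%R by rewrite -lee_fin EFinM -aE -bE.
have a0 : (0 <= a)%R by rewrite fine_ge0// ltW.
have b0 : (0 <= b)%R by rewrite fine_ge0// ltW.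
have M0 : (0 <= 2 * M)%R by rewrite mulr_ge0// (le_trans _ abM)// mulr_ge0.
(* Jensen through the tangent at the mean [r]: integrate [exp r * (1 - r + g) <= exp g]. *)
have jensen (g : T -> R) (r c : R) : P.-integrable [set: T] (EFin \o g) ->
    \int[P]_w (g w)%:E = r%:E ->
    P.-integrable [set: T] (EFin \o (fun w => expR (g w))) ->
    \int[P]_w (expR (g w))%:E = c%:E -> (expR r <= c)%R.
  move=> ig gr ie ec.
  have icr : P.-integrable [set: T] (EFin \o cst (1 - r)%R).
    exact: finite_measure_integrable_cst.
  have : \int[P]_w ((expR r)%:E * (((1 - r)%R%:E) + (g w)%:E)) <= c%:E.
    rewrite -ec; apply: le_integral => //.
      by apply: integrableZl => //; exact: integrableD.
    move=> w _; rewrite -EFinD -EFinM lee_fin.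
    have -> : expR (g w) = (expR r * expR (g w - r))%R by rewrite -expRD subrKC.
    rewrite ler_wpM2l ?expR_ge0//; apply: le_trans (expR_ge1Dx _); lra.
  rewrite integralZl//; last exact: integrableD.
  rewrite integralD// integral_cst//= probability_setT mule1 gr -EFinD -EFinM.
  by rewrite lee_fin subrK mulr1.
have ae : (expR (lam * m) <= a)%R by exact: jensen ilZ ElZ iA aE.
have be : (expR (- (lam * m)) <= b)%R.
  apply: (jensen (fun w => - (lam * Z w))%R _ _ _ _ iB bE).
    exact: integrableN ilZ.
  by under eq_integral do rewrite EFinN; rewrite integralN ?ElZ// integrable_add_def.
(* The exponential of an absolute value is at most the sum of the exponentials of both signs. After
   integration this is [exp (- lam m) a + exp (lam m) b <= 2 a b]. *)
have expint : \int[P]_w (expR (lam * `|Z w - m|))%:E <= (2 * M)%:E.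
  apply: (@le_trans _ _ (\int[P]_w ((expR (- (lam * m)))%:E * (expR (lam * Z w))%:E
     + (expR (lam * m))%:E * (expR (- (lam * Z w)))%:E))).
    apply: ge0_le_integral_nonmeas => w; first by rewrite lee_fin expR_ge0.
    rewrite -!EFinM -EFinD lee_fin -!expRD.
    have [zm|zm] := ger0P (Z w - m)%R.
      by rewrite (_ : lam * _ = - (lam * m) + lam * Z w)%R ?lerDl ?expR_ge0//; ring.
    by rewrite (_ : lam * _ = lam * m - lam * Z w)%R ?lerDr ?expR_ge0//; ring.
  rewrite ge0_integralD//; last 2 first.
  - by apply: measurable_funeM; exact/measurable_EFinP.
  - by apply: measurable_funeM; exact/measurable_EFinP.
  rewrite !integralZl// -/IA -/IB aE bE -!EFinM -EFinD lee_fin.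
  have := expR_gt0 (lam * m); have := expR_gt0 (- (lam * m)) => h1 h2.
  have := ler_wpM2r a0 be; have := ler_wpM2r b0 ae; nra.
rewrite EE unlock.
have le0 : (0 < lam * expR 1)%R by rewrite mulr_gt0// expR_gt0.
(* Apply [powR_le_expR] with [u = lam |Z - m|], after pulling out the factor [lam^-1]. *)
apply: (@le_trans _ _ ((((p / (lam * expR 1)) `^ p * (2 * M))%:E) `^ p^-1)).
  apply: gt0_ler_poweR.
  - by rewrite invr_ge0 ltW.
  - by rewrite in_itv/= leey andbT integral_ge0.
  - by rewrite in_itv/= leey andbT lee_fin mulr_ge0 ?powR_ge0.
  apply: (@le_trans _ _ (\int[P]_w
      (((p / (lam * expR 1)) `^ p)%:E * (expR (lam * `|Z w - m|))%:E))).
    apply: ge0_le_integral_nonmeas => w; first by rewrite poweR_ge0.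
    rewrite -EFinM -EFinB /= lee_fin.
    have u0 : (0 <= lam * `|Z w - m|)%R by rewrite mulr_ge0// ltW.
    have -> : (p / (lam * expR 1) = lam^-1 * (p / expR 1))%R.
      by rewrite invfM mulrCA.
    rewrite -[X in (X `^ p)%R](mulKf (lt0r_neq0 lam0)).
    have l0 : (0 <= lam^-1)%R by rewrite invr_ge0 ltW.
    have pe0 : (0 <= p / expR 1)%R by rewrite divr_ge0 ?expR_ge0// ltW.
    rewrite (powRM _ l0 u0) (powRM _ l0 pe0).
    by rewrite -[leRHS]mulrA ler_wpM2l ?powR_ge0// powR_le_expR.
  rewrite ge0_integralZl_EFin//; last 2 first.
  - apply/measurable_EFinP; apply: measurableT_comp => //.
    apply: measurable_funM => //; apply: measurableT_comp => //.
    exact: measurable_funB.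
  - by rewrite powR_ge0.
  by rewrite EFinM lee_wpmul2l// lee_fin powR_ge0.
rewrite poweR_EFin lee_fin powRM ?powR_ge0//.
by rewrite -powRrM mulfV ?gt_eqF// powRr1// divr_ge0// ltW.
Qed.

End CenteredMoments.

(** * Application to norms of the random vector *)

Section RandomVector.
Context {d : measure_display} {T : measurableType d} {R : realType} {n : nat}.
Variables (P : probability T R) (X : {RV P >-> borel_rV R n}).
Implicit Types (t x y : 'rV[R]_n) (N : 'rV[R]_n -> R).

Lemma measurable_continuous_RV (f : 'rV[R]_n -> R) : continuous f ->
  measurable_fun [set: T] (fun w => f (X w)).
Proof.
move=> cf; have mX := @measurable_funPT _ _ _ _ X.
have mf : measurable_fun [set: borel_rV R n] (f : borel_rV R n -> R).
  apply: (measurability _ (RGenOInfty.measurableE R)).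
  move=> _ [_ [a ->] <-]; rewrite setTI; apply: sub_sigma_algebra.
  by apply: open_comp => //; exact: interval_open.
exact: (measurableT_comp mf mX).
Qed.

Lemma norm0 N : is_norm N -> N 0 = 0.
Proof. by move=> [_ NZ _]; rewrite -(scale0r 0) NZ normr0 mul0r. Qed.

Lemma norm_ge0 N x : is_norm N -> 0 <= N x.
Proof.
move=> nN; have [ND NZ _] := nN; have := ND x (- x).
by rewrite subrr (norm0 nN) -scaleN1r NZ normrN normr1 mul1r; lra.
Qed.

Lemma norm_continuous N : is_norm N -> continuous N.
Proof.
move=> [ND NZ _]; apply: (seminorm_lipschitz_continuous ND NZ) => x y.
rewrite ler_norml; apply/andP; split; last first.
  by rewrite lerBlDr -{1}(subrK y x) ND.
rewrite lerNl opprB lerBlDr -{1}(subrK x y) -opprB -scaleN1r.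
by apply: le_trans (ND _ _) _; rewrite NZ normrN normr1 mul1r.
Qed.

Lemma dot_continuous t : continuous (dot t).
Proof.
apply: (@seminorm_lipschitz_continuous _ _ _ (fun x => `|dot t x|)) => [x y|a x|x y].
- by rewrite dotDr ler_normD.
- by rewrite dotZr normrM.
- by rewrite dotBr.
Qed.

Lemma convex_function_norm N (lam : R) : is_norm N -> 0 <= lam ->
  convex_function (E := 'rV[R]_n) setT (fun x => lam * N x).
Proof.
move=> [ND NZ _] lam0 t x y _ _.
change (lam * N (t%:inum *: x + (1 - t%:inum) *: y) <=
  t%:inum * (lam * N x) + (1 - t%:inum) * (lam * N y)).
rewrite !(mulrCA _ lam) -mulrDr ler_wpM2l//; apply: le_trans (ND _ _) _.
by rewrite !NZ !ger0_norm// subr_ge0.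
Qed.

Lemma euclidean_normZ a t : euclidean_norm (a *: t) = `|a| * euclidean_norm t.
Proof.
by rewrite /euclidean_norm dotZl dotZr mulrA -expr2 sqrtrM ?sqr_ge0// sqrtr_sqr.
Qed.

Lemma euclidean_norm_gt0 t : t != 0 -> 0 < euclidean_norm t.
Proof.
move=> t0; rewrite sqrtr_gt0 lt_neqAle eq_sym sumr_ge0 ?andbT; last first.
  by move=> i _; rewrite -expr2 sqr_ge0.
apply: contra t0; rewrite psumr_eq0 => [/allP h|i _]; last first.
  by rewrite -expr2 sqr_ge0.
apply/eqP/rowP => i; rewrite mxE.
by have := h i (mem_index_enum i); rewrite /= mulf_eq0 orbb => /eqP.
Qed.

Local Open Scope ereal_scope.

Lemma momentZ (p a : R) t : (0 < p)%R ->
  moment X p (a *: t) = `|a|%:E * moment X p t.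
Proof.
move=> p0; rewrite /moment unlock.
have -> : \int[P]_w `|(dot (a *: t) (X w))%:E| `^ p =
    \int[P]_w ((`|a| `^ p)%:E * (`|(dot t (X w))%:E| `^ p)).
  by apply: eq_integral => w _; rewrite dotZl/= normrM powRM.
rewrite ge0_integralZl_EFin ?powR_ge0//; last 2 first.
- by move=> w _; exact: poweR_ge0.
- apply/measurable_EFinP; apply: (measurableT_comp (measurable_powR _)).
  apply: measurableT_comp => //.
  exact: measurable_continuous_RV (@dot_continuous t).
rewrite poweRM ?lee_fin ?powR_ge0//; last first.
  by apply: integral_ge0 => w _; exact: poweR_ge0.
by rewrite poweR_EFin -powRrM mulfV ?gt_eqF// powRr1.
Qed.

(** Both sides are homogeneous in [t], so the unit sphere suffices for [t != 0]; at [t = 0] both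
    sides vanish. *)
Lemma moments_grow_regularly_all (alpha p q : R) t :
  moments_grow_regularly X alpha -> (2 <= q)%R -> (q <= p)%R ->
  moment X p t <= (alpha * (p / q))%:E * moment X q t.
Proof.
move=> reg q2 qp.
have q0 : (0 < q)%R by exact: lt_le_trans q2.
have p0 : (0 < p)%R by exact: lt_le_trans qp.
have [->|t0] := eqVneq t (0 : 'rV[R]_n)%R.
  by rewrite -(scale0r (0 : 'rV[R]_n)%R) !momentZ// normr0 !mul0e mule0.
have := euclidean_norm_gt0 t0; set e := euclidean_norm t => e0.
have [u -> u1] : exists2 u, t = (e *: u)%R & euclidean_norm u = 1%R.
  exists (e^-1 *: t)%R; first by rewrite scalerA mulfV ?gt_eqF// scale1r.
  by rewrite euclidean_normZ gtr0_norm ?invr_gt0// mulVf ?gt_eqF.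
rewrite !momentZ// muleCA; apply: lee_wpmul2l; first by rewrite lee_fin.
exact: reg.
Qed.

Lemma moment_le_weak_moment N (p : R) t :
  dual_norm N t <= 1 -> moment X p t <= weak_moment X N p.
Proof. by move=> t1; apply: ereal_sup_ubound; exists t. Qed.

Lemma weak_moment_ge0 N (p : R) : 0 <= weak_moment X N p.
Proof.
apply: le_trans (Lnorm_ge0 _ _ _) (@moment_le_weak_moment N p (0 : 'rV[R]_n)%R _).
by apply/dual_norm_le1P => x _; rewrite -(scale0r (0 : 'rV[R]_n)%R) dotZl mul0r.
Qed.

(** For [q >= p], regularity between [p] and [q] gives moments at most [tau * (q / p)] with
    [tau = alpha * sig], exactly the input of [exp_moment_regular]. *)
Lemma cumulant_dual_ball (N : 'rV[R]_n -> R) (alpha sig p : R) t :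
  moments_grow_regularly X alpha -> (0 < alpha)%R -> (0 < sig)%R ->
  (2 <= p)%R -> weak_moment X N p <= sig%:E -> dual_norm N t <= 1 ->
  cumulant X ((p / (2 * expR 1 * (alpha * sig))) *: t)%R
    <= (ln (4 * expR p))%:E.
Proof.
move=> reg a0 s0 p2 wp t1.
set s := (p / _)%R.
have p0 : (0 < p)%R by exact: lt_le_trans p2.
have sge0 : (0 <= s)%R.
  by rewrite divr_ge0 ?(ltW p0)// !mulr_ge0 ?expR_ge0// ltW.
have mt := measurable_continuous_RV (@dot_continuous t).
have M0 : (0 < 4 * expR p)%R by rewrite mulr_gt0// expR_gt0.
rewrite -lne_EFin// /cumulant lee_lne ?in_itv/= ?leey ?andbT ?lee_fin ?(ltW M0)//;
  last by rewrite expectation_ge0// => w; exact: expR_ge0.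
apply: (@le_trans _ _ (\int[P]_w (expR (s * `|dot t (X w)|))%:E)).
  rewrite unlock; apply: ge0_le_integral_nonmeas => w.
    by rewrite lee_fin expR_ge0.
  by rewrite lee_fin ler_expR dotZl ler_wpM2l// ler_norm.
apply: exp_moment_regular => //.
- by apply: le_trans p2; rewrite ler1n.
- exact: mulr_gt0.
move=> q pq; apply: le_trans (moments_grow_regularly_all _ reg p2 pq) _.
have -> : (alpha * sig * (q / p) = alpha * (q / p) * sig)%R by rewrite mulrAC.
rewrite [leRHS]EFinM; apply: lee_wpmul2l.
  by rewrite lee_fin mulr_ge0 ?divr_ge0 ?ltW// (lt_le_trans p0).
exact: le_trans (moment_le_weak_moment _ t1) wp.
Qed.

(** For each [y], testing the Legendre transform at [s *: t], with [t] norming [x - y], bounds the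
    cost below by [s / beta * N (x - y) - L]. The triangle inequality then removes [y]. *)
Lemma inf_convolution_norm_ge N (s beta L : R) x :
  is_norm N -> (0 < s)%R -> (0 < beta)%R ->
  (forall t, dual_norm N t <= 1 -> cumulant X (s *: t)%R <= L%:E) ->
  ((s / beta * N x) - L)%:E <=
    inf_convolution (fun y => s / beta * N y)%R
      (fun y => cumulant_legendre X (beta^-1 *: y)%R) x.
Proof.
move=> nN s0 b0 cL; apply: le_ereal_inf_tmp => _ [y _ <-].
have [t [tN tz]] := norming_functional (x - y)%R nN.
have t1 : dual_norm N t <= 1.
  by apply/dual_norm_le1P => z; exact: le_trans.
apply: (@le_trans _ _ ((s / beta * N y)%:E + ((s / beta * N (x - y))%:E - L%:E))).
  rewrite -EFinB -EFinD lee_fin addrA lerB// -mulrDr ler_wpM2l//.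
    by rewrite divr_ge0// ltW.
  by have := norm_triangle nN y (x - y); rewrite addrC subrK.
rewrite leeD2l//.
apply: (@le_trans _ _ ((dot (beta^-1 *: (x - y)) (s *: t))%:E - cumulant X (s *: t)%R)).
  rewrite dotZl dotZr dotC tz mulrA (mulrC _ s) leeD2l// leeN2.
  exact: cL.
by apply: ereal_sup_ubound; exists (s *: t)%R.
Qed.

Lemma centered_norm_moment_le N (alpha beta sig p : R) :
  (0 < alpha)%R -> (0 < beta)%R -> (0 < sig)%R -> (2 <= p)%R ->
  moments_grow_regularly X alpha -> convex_IC X beta -> is_norm N ->
  weak_moment X N p <= sig%:E ->
  'N[P]_(p%:E)[(fun w => (N (X w))%:E - 'E_P[fun w' => N (X w')])] <=
    (4 * Num.sqrt 2 * expR 1 * alpha * beta * sig)%:E.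
Proof.
move=> a0 b0 sig0 p2 reg IC nN wp.
have p0 : (0 < p)%R by exact: lt_le_trans p2.
pose s : R := (p / (2 * expR 1 * (alpha * sig)))%R.
have s0 : (0 < s)%R by rewrite divr_gt0// !mulr_gt0// expR_gt0.
pose lam : R := (s / beta)%R.
have lam0 : (0 < lam)%R by rewrite divr_gt0.
pose M : R := (4 * expR p)%R.
have M0 : (0 < M)%R by rewrite mulr_gt0// expR_gt0.
have mN : measurable_fun [set: T] (fun w => N (X w)).
  exact: measurable_continuous_RV (norm_continuous nN).
have cL t : dual_norm N t <= 1 -> cumulant X (s *: t)%R <= (ln M)%:E.
  exact: cumulant_dual_ball.
have lbf : has_lbound (range (fun x => lam * N x)%R).
  by exists 0%R => _ [x _ <-]; rewrite mulr_ge0 ?norm_ge0// ltW.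
have := IC _ (convex_function_norm nN (ltW lam0)) lbf.
set J := (\int[P]_w expeR _) => ICN.
(* The infimum convolution is at least [lam N - ln M]; exponentiating turns [ln M] into the factor
   [M]. *)
have J_ge : \int[P]_w (expR (lam * N (X w)))%:E <= M%:E * J.
  have -> : \int[P]_w (expR (lam * N (X w)))%:E =
      M%:E * \int[P]_w (expR (lam * N (X w) - ln M))%:E.
    rewrite -ge0_integralZl_EFin ?(ltW M0)//; last first.
      apply/measurable_EFinP; apply: measurableT_comp => //.
      by apply: measurable_funB => //; exact: measurable_funM.
    apply: eq_integral => w _; rewrite -EFinM expRB lnK ?posrE//.
    by rewrite (mulrC M) divfK// gt_eqF.
  apply: lee_wpmul2l; first by rewrite lee_fin ltW.
  apply: ge0_le_integral_nonmeas => w; first by rewrite lee_fin expR_ge0.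
  have := inf_convolution_norm_ge (X w) nN s0 b0 cL.
  by rewrite -lee_expeR.
have AB : \int[P]_w (expR (lam * N (X w)))%:E *
    \int[P]_w (expR (- (lam * N (X w))))%:E <= M%:E.
  apply: (@le_trans _ _ (M%:E * J * \int[P]_w (expR (- (lam * N (X w))))%:E)).
    apply: lee_wpmul2r => //.
    by apply: integral_ge0 => w _; rewrite lee_fin expR_ge0.
  rewrite -muleA -[leRHS]mule1; apply: lee_wpmul2l; first by rewrite lee_fin ltW.
  by move: ICN; rewrite unlock.
apply: le_trans (Lnorm_centered_le mN _ p0 lam0 AB) _.
  by move=> w; exact: norm_ge0.
rewrite lee_fin.
(* The final constant is the product of [2 alpha beta sig] and [(2M)^(1/p) = 8^(1/p) e], where
   [8^(1/p) <= sqrt 8] because [p >= 2]. *)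
have -> : (p / (lam * expR 1) = 2 * (alpha * beta * sig))%R.
  by rewrite /lam /s; field; rewrite !gt_eqF// expR_gt0.
have MpE : ((2 * M) `^ p^-1 = 8 `^ p^-1 * expR 1)%R.
  rewrite /M mulrA powRM ?expR_ge0// -expRM mulfV ?gt_eqF//.
  by congr (_ `^ _ * _)%R; lra.
have sqrt8 : (8 `^ p^-1 <= 2 * Num.sqrt 2 :> R)%R.
  have -> : (2 * Num.sqrt 2 = 8 `^ 2^-1 :> R)%R.
    rewrite powR12_sqrt// (_ : 8 = 2 ^+ 2 * 2)%R; last by rewrite -exprSr -natrX.
    by rewrite sqrtrM ?sqr_ge0// sqrtr_sqr ger0_norm.
  by rewrite ler_powR ?lef_pV2 ?posrE//; lra.
rewrite MpE.
have abs0 : (0 < alpha * beta * sig)%R by rewrite !mulr_gt0.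
have := ler_wpM2l (ltW (mulr_gt0 abs0 (expR_gt0 1))) sqrt8.
by move=> h; nra.
Qed.

End RandomVector.

Unset Implicit Arguments.

Theorem theorem2p4 (R : realType) :
  exists C : R, [/\ C = 4 * Num.sqrt 2 * expR 1, C < 16 &
    forall (n : nat) (alpha beta : R)
      (d : measure_display) (T : measurableType d) (P : probability T R)
      (X : {RV P >-> borel_rV R n}),
      (1 <= n)%N -> 0 < alpha -> 0 < beta ->
      symmetric_rv X ->
      moments_grow_regularly X alpha ->
      convex_IC X beta ->
      forall (N : 'rV[R]_n -> R) (p : R), is_norm N -> 2 <= p ->
        ('N[P]_(p%:E)[(fun w => (N (X w))%:E - 'E_P[fun w' => N (X w')])]
          <= (C * alpha * beta)%:E * weak_moment X N p)%E].
Proof.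
exists (4 * Num.sqrt 2 * expR 1).
have s20 : 0 < Num.sqrt 2 :> R by rewrite sqrtr_gt0.
have C0 : 0 < 4 * Num.sqrt 2 * expR 1 :> R by rewrite !mulr_gt0// expR_gt0.
split=> [//||n alpha beta d T P X _ a0 b0 _ reg IC N p nN p2].
  (* Multiplying [e < 2 sqrt 2] by [4 sqrt 2] gives 16. *)
  have s22 : Num.sqrt 2 * Num.sqrt 2 = 2 :> R by rewrite -expr2 sqr_sqrtr.
  have := @expR1_lt_sqrt8 R; rewrite -(ltr_pM2l (mulr_gt0 (ltr0n R 4) s20)).
  by move=> h; nra.
set C := 4 * _ * _.
have Cab0 : 0 < C * alpha * beta by rewrite !mulr_gt0.
have := weak_moment_ge0 X N p.
(* The value [-oo] contradicts nonnegativity, and for [+oo] the right side is infinite. *)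
case wE : (weak_moment X N p) => [r| |] // r0; last first.
  by rewrite gt0_muley ?lte_fin// leey.
(* The weak moment [r] may be 0, while the finite bound needs [sig > 0]. The excess of [sig] over
   [r] is chosen to add exactly [e] to the right side. *)
apply/lee_addgt0Pr => e e0.
pose sig := r + e / (C * alpha * beta).
have sig0 : 0 < sig by rewrite ltr_wpDl// divr_gt0.
have -> : ((C * alpha * beta)%:E * r%:E + e%:E = (C * alpha * beta * sig)%:E)%E.
  by rewrite -EFinM -EFinD /sig mulrDr (mulrC _ (e / _)) divfK// gt_eqF.
apply: centered_norm_moment_le => //.
by rewrite wE lee_fin lerDl divr_ge0// ltW.
Qed.
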